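(* Let $u$ be the (sufficiently smooth) solution of $u'(t)+Au(t)+Bu(t)=f(t)$, $t\in(0,T]$, $u(0)=u^0$, let $U^n$, $n=2,\dots,N$, be the solution of the variable step-size BDF2 scheme $\bar\partial_B^2U^n+AU^n+BU^n=f^n$ ($n=2,\dots,N$) with starting approximations $U^0,U^1$, and let $e^n=u(t^n)-U^n$. Let $r_{\max}\le R$ with $1<R<R_0=\sqrt2+1\approx2.414$, and set $c_3=\frac{(1+R)^2}{1+2R-R^2}$. If $e^0=0$ and there exist constants $c_1$ and $c_2$ such that $k_{\max}$ satisfies $$(4+2\sqrt2)\gamma^2k_{\max}\le c_1<1\qquad\text{and}\qquad2c_3\gamma^2k_{\max}\le c_2<1,$$ then for $n=2,3,\dots,N$ $$|e|^2_{l^\infty(t^2,t^n;H)}+\|e\|^2_{l^2(t^2,t^n;V)}\le C\Big(|e^1|^2+k_{\max}\|e^1\|^2+\frac{k_{\max}k_2}{k_1^2}|e^1|^2+k_{\max}^4\Big),$$ where $C$ depends only on $\gamma$, $c_i$ ($i=1,2,3,4$), $R$, $t^n$ and $\Phi_n:=\sum_{j=2}^{n-2}[r_j-r_{j+2}]_+$, $[x]_+:=\frac{|x|+x}2$.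
   Context: Let $(H,(\cdot,\cdot))$ be a Hilbert space with norm $|\cdot|$, and $A:D(A)\to H$ a positive definite, self-adjoint, linear operator with $D(A)$ dense in $H$. Let $V=D(A^{1/2})$ with norm $\|v\|=|A^{1/2}v|=(Av,v)^{1/2}$, and let $V^*$ be its dual, $V\subset H\subset V^*$, with norm $\|v\|_*=|A^{-1/2}v|$; $(\cdot,\cdot)$ also denotes the duality pairing between $V^*$ and $V$. $B$ is a linear operator with $|Bu|\le\gamma(t)\|u\|$ for all $u\in V$, $t\in J:=(0,T]$, where $\gamma:J\to\mathbb R$ is a smooth nonnegative function, and (without argument) $\gamma:=\max_{t\in J}\gamma(t)$. $f:[0,T]\to H$. Partition: $N\ge2$, $0=t^0<t^1<\dots<t^N=T$, $k_n=t^n-t^{n-1}$, $r_n=k_n/k_{n-1}$ and $s_n=r_n/(1+r_n)=k_n/(k_n+k_{n-1})$ for $n\ge2$; $k_{\max}=\max_{2\le n\le N}k_n$, $r_{\max}=\max_{2\le n\le N}r_n$; $f^n=f(t^n)$. Difference operators: $\bar\partial U^n=(U^n-U^{n-1})/k_n$ and $\bar\partial_B^2U^n=(1+s_n)\bar\partial U^n-s_n\bar\partial U^{n-1}$. The scheme is understood in variational form: $(\bar\partial_B^2U^n,v)+(AU^n,v)+(BU^n,v)=(f^n,v)$ for all $v\in V$, with $U^n\in V$; $U^1\in V$. Consistency error: $d_2^n=\bar\partial_B^2u(t^n)-u'(t^n)$, $n\ge2$; $c_4$ is the constant (determined by derivatives of the exact solution $u$) in the consistency bound $|d_2^n|\le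 c_4k_n^2$, $n\ge2$. The solution $u$ is assumed regular enough for this bound to hold. Norms: $|e|_{l^\infty(t^{n_1},t^{n_2};H)}=\max_{n_1\le j\le n_2}|e^j|$ and $\|e\|_{l^2(t^{n_1},t^{n_2};V)}=\big(\sum_{j=n_1}^{n_2}k_j\|e^j\|^2\big)^{1/2}$. Empty sums are $0$. *)

(* Defs.v *)
From HB Require Import structures.
From mathcomp Require Import all_boot all_order all_algebra sesquilinear.
From mathcomp Require Import all_classical all_reals all_analysis.

Set Implicit Arguments.
Unset Strict Implicit.
Unset Printing Implicit Defensive.

Import Order.TTheory GRing.Theory Num.Theory.
Import numFieldNormedType.Exports.

Local Open Scope classical_set_scope.
Local Open Scope ring_scope.

(** * Operators in a real Hilbert space

   A real Hilbert space is a [completeNormedModType] [H] together with a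
   positive definite symmetric form [dot : {dot H for idfun}] inducing its
   norm, see [induces_norm].  (A complex Hilbert space is also a real one, for
   the real part of its inner product.) *)

(* A possibly unbounded operator; its values outside [dom] are irrelevant. *)
Record operator (H : Type) := Operator {
  dom : set H;
  apply_op :> H -> H
}.

Section Operators.
Variables (R : realType) (H : completeNormedModType R).
Variable dot : {dot H for (@idfun R)}.

Definition induces_norm := forall v : H, dot v v = `|v| ^+ 2.

Definition linear_on (D : set H) (L : H -> H) :=
  forall (a : R) (v w : H), D v -> D w -> L (a *: v + w) = a *: L v + L w.

Definition linear_operator (A : operator H) :=
  [/\ dom A 0,
      forall (a : R) (v w : H), dom A v -> dom A w -> dom A (a *: v + w)
    & linear_on (dom A) A].

(* The left-hand side of the equivalence says that [(w, z)] is in the graph of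
   the adjoint of [A], the right-hand side that it is in the graph of [A]. *)
Definition self_adjoint (A : operator H) :=
  dense (dom A) /\
  forall w z : H,
    (forall v, dom A v -> dot (A v) w = dot v z) <-> (dom A w /\ A w = z).

Definition positive_definite (A : operator H) :=
  forall v, dom A v -> v != 0 -> 0 < dot (A v) v.

(* [S] is the square root of [A]: the (unique) positive self-adjoint operator
   with [S \o S = A], equality of domains included. *)
Definition is_sqrt_op (A S : operator H) :=
  [/\ linear_operator S,
      self_adjoint S,
      forall v, dom S v -> 0 <= dot (S v) v,
      dom A = [set v | dom S v /\ dom S (S v)]
    & forall v, dom A v -> A v = S (S v)].

(* With [S] the square root of [A]: the space [V = D(A^(1/2))], its norm, and
   the pairing of [A v], an element of the dual of [V], with [w] in [V]; for
   [v] in [dom A] this pairing is [dot (A v) w]. *)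
Definition Vspace (S : operator H) : set H := dom S.
Definition Vnorm (S : operator H) (v : H) : R := `|S v|.
Definition Apairing (S : operator H) (v w : H) : R := dot (S v) (S w).

End Operators.

(** * Calculus on intervals *)

(* Derivative relative to [J], hence one-sided at the endpoints of [J]. *)
Definition has_deriv_in (R : realType) (W : normedModType R) (J : set R)
    (g : R -> W) (t : R) (l : W) :=
  (s - t)^-1 *: (g s - g t) @[s --> within J t^'] --> l.

Definition smooth_on (R : realType) (J : set R) (g : R -> R) :=
  exists D : nat -> R -> R^o,
    (forall t, J t -> D 0%N t = g t) /\
    forall (m : nat) (t : R), J t -> has_deriv_in J (D m) t (D m.+1 t).

Definition is_max_on (R : realType) (J : set R) (g : R -> R) (m : R) :=
  (g @` J) m /\ ubound (g @` J) m.

(** * Partitions and the variable-step BDF2 difference operator *)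

Section Grid.
Variables (R : realType) (N : nat) (t : nat -> R).

Definition is_partition (T : R) :=
  [/\ t 0%N = 0, t N = T & forall n, (n < N)%N -> t n < t n.+1].

Definition step (n : nat) : R := t n - t n.-1.
Definition ratio (n : nat) : R := step n / step n.-1.
Definition sratio (n : nat) : R := ratio n / (1 + ratio n).

(* The steps and ratios being positive, the default value 0 is harmless. *)
Definition kmax : R := \big[Num.max/0]_(2 <= n < N.+1) step n.
Definition rmax : R := \big[Num.max/0]_(2 <= n < N.+1) ratio n.

Definition pos_part (x : R) : R := (`|x| + x) / 2.

(* The sum over [2 <= j <= n - 2]. *)
Definition Phi (n : nat) : R :=
  \sum_(2 <= j < n.-1) pos_part (ratio j - ratio j.+2).

Section Differences.
Variable H : completeNormedModType R.

Definition bdiff (x : nat -> H) (n : nat) : H :=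
  (step n)^-1 *: (x n - x n.-1).

Definition bdf2 (x : nat -> H) (n : nat) : H :=
  (1 + sratio n) *: bdiff x n - sratio n *: bdiff x n.-1.

Definition linf_norm (e : nat -> H) (n1 n2 : nat) : R :=
  \big[Num.max/0]_(n1 <= j < n2.+1) `|e j|.

Definition l2V_norm (S : operator H) (e : nat -> H) (n1 n2 : nat) : R :=
  Num.sqrt (\sum_(n1 <= j < n2.+1) step j * Vnorm S (e j) ^+ 2).

End Differences.
End Grid.

(* Main.v *)
(* The error satisfies the scheme with right-hand side [d^n].  Testing with the
   difference quotient [x^n] of [e^n] gives, for ratios below [1 + sqrt 2] and
   after a Gronwall argument in [||e^n||^2], a bound on [sum k_n |x^n|^2] by
   [||e^1||^2 + k_2 |e^1|^2 / k_1^2 + k^4].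

   Testing with [2 k_n (1 - s_n) e^n] gives, with [E_n = |e^n|^2],
   [E_n - E_(n-1) - s_n^2 (E_n - E_(n-2)) + 2 k_n (1 - s_n) ||e^n||^2] on the left,
   up to terms [|e^n - e^(n-1)|^2], which sum to [k_max sum k_n |x^n|^2] and are
   under control.  Summing by parts with lag two leaves
   [(1 - s_m^2) E_m - s_(m-1)^2 E_(m-1)], coercive since
   [1 - 2 (R / (1 + R))^2 = 1 / c_3 > 0], and the sum of
   [[s_j^2 - s_(j+2)^2]_+ E_j], so that Gronwall's lemma brings in [Phi_n]. *)

Require Import Defs.
From HB Require Import structures.
From mathcomp Require Import all_boot all_order all_algebra sesquilinear.
From mathcomp Require Import all_classical all_reals all_analysis.
From mathcomp Require Import ring lra.

Set Implicit Arguments.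
Unset Strict Implicit.
Unset Printing Implicit Defensive.

Import Order.TTheory GRing.Theory Num.Theory.
Import numFieldNormedType.Exports.

Local Open Scope classical_set_scope.
Local Open Scope ring_scope.

(** * Summation and Gronwall *)

Section RealSequences.
Variable R : realType.
Implicit Types (q E w y k X : nat -> R).

Lemma pos_part_ge0 (x : R) : 0 <= pos_part x.
Proof. by have := ler_norm (- x); rewrite normrN /pos_part; lra. Qed.

Lemma le_pos_part (x : R) : x <= pos_part x.
Proof. by have := ler_norm x; rewrite /pos_part; lra. Qed.

Lemma pos_part_le (x y : R) : 0 <= y -> x <= y -> pos_part x <= y.
Proof. by rewrite /pos_part; case: (ler0P x) => ? ? ?; lra. Qed.

Lemma sum_nat_ge0 (F : nat -> R) m n :
  (forall j, (m <= j < n)%N -> 0 <= F j) -> 0 <= \sum_(m <= j < n) F j.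
Proof. by move=> F0; rewrite big_nat; apply: sumr_ge0. Qed.

Lemma ler_sum_nat_widen (F : nat -> R) a m n :
  (m <= n)%N -> (forall j, (a <= j < n)%N -> 0 <= F j) ->
  \sum_(a <= j < m) F j <= \sum_(a <= j < n) F j.
Proof.
move=> mn F0; have [am|ma] := leqP a m; last first.
  by rewrite [leLHS]big_geq ?(ltnW ma) //; apply: sum_nat_ge0.
rewrite (big_cat_nat am mn) /= lerDl; apply: sum_nat_ge0 => j /andP[mj jn].
by apply: F0; rewrite (leq_trans am mj).
Qed.

Lemma ler_sum_nat_in (F G : nat -> R) m n :
  (forall j, (m <= j < n)%N -> F j <= G j) ->
  \sum_(m <= j < n) F j <= \sum_(m <= j < n) G j.
Proof. by move=> FG; rewrite big_nat [leRHS]big_nat; apply: ler_sum. Qed.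

(** The majorant [G] satisfies the reverse inequality [\sum w j * G j + F <= a * G m], because
    [1 + x <= expR x]. The delayed term [b * y m.-1] does not enter the exponent: [G] is
    nondecreasing, so the [b] on the left absorbs it. *)
Lemma discrete_gronwall (a b F : R) w y n :
  0 < a -> 0 <= b -> 0 <= F -> (forall j, (2 <= j < n)%N -> 0 <= w j) ->
  y 1%N <= F / a ->
  (forall m, (2 <= m <= n)%N ->
     (a + b) * y m <= b * y m.-1 + \sum_(2 <= j < m) w j * y j + F) ->
  forall m, (1 <= m <= n)%N ->
    y m <= F / a * expR ((\sum_(2 <= j < m) w j) / a).
Proof.
move=> a0 b0 F0 w0 y1 Hy.
pose W m := \sum_(2 <= j < m) w j; pose G m := F / a * expR (W m / a).
have Fa0 : 0 <= F / a by rewrite divr_ge0 // ltW.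
have G0 m : 0 <= G m by rewrite mulr_ge0 // expR_ge0.
have aF : a * (F / a) = F by rewrite mulrC divfK // gt_eqF.
have WS m : (2 <= m)%N -> W m.+1 = W m + w m.
  by move=> m2; rewrite /W big_nat_recr.
have GS m : (2 <= m < n)%N -> G m * (1 + w m / a) <= G m.+1.
  move=> /andP[m2 mn]; rewrite /G WS // mulrDl expRD mulrA ler_wpM2l //.
  by rewrite mulr_ge0 ?expR_ge0.
  by rewrite expR_ge1Dx.
have sumG m : (2 <= m <= n)%N -> \sum_(2 <= j < m) w j * G j <= a * G m - F.
  elim: m => [//|m IH] /andP[m2 mn].
  move: m2; rewrite leq_eqVlt => /predU1P[m1|m2].
    by rewrite -m1 big_geq // /G /W big_geq // mul0r expR0 mulr1 aF subrr.
  rewrite big_nat_recr //=.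
  have m2' : (2 <= m)%N by [].
  have := IH; rewrite m2' (ltnW mn) => /(_ isT) {}IH.
  have := GS m; rewrite m2' mn => /(_ isT) /(ler_wpM2l (ltW a0)) {}GS.
  have e : a * (G m * (1 + w m / a)) = a * G m + w m * G m.
    by field; rewrite gt_eqF.
  by rewrite e in GS; lra.
have Gmono m : (1 <= m < n)%N -> G m <= G m.+1.
  case: m => [//|[|m]] mn.
    by rewrite /G /W !big_geq.
  apply: (le_trans _ (GS m.+2 mn)); rewrite ler_peMr // lerDl divr_ge0 ?(ltW a0) //.
  exact: w0.
elim/ltn_ind => m IH /andP[m1 mn]; rewrite -/(W m) -/(G m).
move: m1; rewrite leq_eqVlt => /predU1P[m1|m2].
  by rewrite -m1 /G /W big_geq // mul0r expR0 mulr1.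
have := Hy m; rewrite m2 mn => /(_ isT) {}Hy.
have yG j : (1 <= j < m)%N -> y j <= G j.
  by move=> /andP[j1 jm]; apply: IH => //; rewrite j1 (leq_trans (ltnW jm)).
have sy : \sum_(2 <= j < m) w j * y j <= a * G m - F.
  apply: (le_trans _ (sumG m _)); last by rewrite m2 mn.
  rewrite big_nat [leRHS]big_nat; apply: ler_sum => j /andP[j2 jm].
  rewrite ler_wpM2l ?yG ?jm ?(ltnW j2) //.
  by apply: w0; rewrite j2 (leq_trans jm).
have by1 : b * y m.-1 <= b * G m.
  rewrite ler_wpM2l //; case: m m2 mn yG {IH Hy sy} => [//|m] m2 mn yG /=.
  apply: (le_trans _ (Gmono m _)); last by rewrite -ltnS m2 mn.
  by apply: yG; rewrite -ltnS m2 /=.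
rewrite -(ler_pM2l (_ : 0 < a + b)); first by lra.
by rewrite ltr_wpDr.
Qed.

(** Summation by parts with lag two: for [2 <= j <= m - 2] the factor of [E j] is [q j - q j.+2],
    the last two terms keep their full weight, and the contributions of [E 0] and [E 1] at the lower
    end are dropped by sign. *)
Lemma sum_lag2_le q E m :
  q 1%N = 0 -> (forall j, 0 <= q j) -> (forall j, 0 <= E j) -> (2 <= m)%N ->
  \sum_(2 <= j < m.+1) q j * (E j - E j.-2) <=
    q m * E m + q m.-1 * E m.-1
    + \sum_(2 <= j < m.-1) pos_part (q j - q j.+2) * E j.
Proof.
move=> q1 q0 E0; elim: m => [//|[//|[|m]] IH] _.
  rewrite big_nat1 big_geq //= q1 mul0r !addr0 mulrBr lerBlDr lerDl.
  by rewrite mulr_ge0.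
case: m IH => [|m] IH.
  rewrite big_nat_recr // big_nat1 /= big_geq //.
  by have := mulr_ge0 (q0 2%N) (E0 0%N); have := mulr_ge0 (q0 3%N) (E0 1%N); lra.
rewrite big_nat_recr //= [in X in _ <= X]big_nat_recr //=.
have /= {}IH := IH isT.
have := ler_wpM2r (E0 m.+2) (le_pos_part (q m.+2 - q m.+4)).
by lra.
Qed.

End RealSequences.

(** * Stability on a grid *)

Section Grid.
Variables (R : realType) (t : nat -> R) (n : nat) (Rr : R).
Hypothesis t0 : t 0%N = 0.
Hypothesis t_lt : forall j, (j < n)%N -> t j < t j.+1.
Hypothesis ratio_le : forall j, (2 <= j <= n)%N -> Defs.ratio t j <= Rr.
Hypothesis Rr1 : 1 < Rr.
Hypothesis Rr_lt : Rr < Num.sqrt 2 + 1.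

Local Notation k := (step t).
Local Notation r := (Defs.ratio t).
Local Notation s := (sratio t).
Local Notation p := (2 + Num.sqrt 2 : R).
Let c3 := (1 + Rr) ^+ 2 / (1 + 2 * Rr - Rr ^+ 2).

Let sqrt2_gt1 : 1 < Num.sqrt 2 :> R.
Proof. by rewrite -[ltLHS]sqrtr1 ltr_sqrt ?ltr1n. Qed.

Let sqrt2_sq : Num.sqrt 2 * Num.sqrt 2 = 2 :> R.
Proof. by rewrite -expr2 sqr_sqrtr. Qed.

Let Rr_quad : 0 < 1 + 2 * Rr - Rr ^+ 2.
Proof.
(* The critical ratio [1 + sqrt 2] is the positive root of this quadratic, the denominator of
   [c3]. *)
have -> : 1 + 2 * Rr - Rr ^+ 2 =
    (Num.sqrt 2 + 1 - Rr) * (Num.sqrt 2 - 1 + Rr) by ring: sqrt2_sq.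
by move: Rr1 Rr_lt sqrt2_gt1 => ? ? ?; apply: mulr_gt0; lra.
Qed.

(** * Steps, ratios and the weights [s j] *)

Lemma step_gt0 j : (1 <= j <= n)%N -> 0 < k j.
Proof. by case: j => [//|j] /andP[_ jn]; rewrite /step subr_gt0 t_lt. Qed.

Lemma ratio_gt0 j : (2 <= j <= n)%N -> 0 < r j.
Proof.
case: j => [//|[//|j]] jn; rewrite divr_gt0 //= step_gt0 //.
by rewrite /= ltnW.
Qed.

(* [step t 0 = 0] and division by [0] gives [0]. *)
Lemma sratio1 : s 1%N = 0.
Proof. by rewrite /sratio /Defs.ratio {2}/step /= subrr invr0 mulr0 mul0r. Qed.

Lemma sratio_ge0 j : (j <= n)%N -> 0 <= s j.
Proof.
case: j => [|[|j]] jn.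
- by rewrite /sratio /Defs.ratio {1}/step /= subrr !mul0r.
- by rewrite sratio1.
- by have /ltW r0 := ratio_gt0 (j := j.+2) jn; rewrite divr_ge0 // addr_ge0.
Qed.

Lemma onem_sratio j : (2 <= j <= n)%N -> 1 - s j = (1 + r j)^-1.
Proof.
by move=> /ratio_gt0 r0; rewrite /sratio; field; rewrite gt_eqF // addr_gt0.
Qed.

(** The factor [r ^+ 2 / (1 + r)] increases with the ratio and equals [1 + sqrt 2 / 2 = 2 - p^-1] at
    [r = 1 + sqrt 2]. Hence [2 * k j.-1 * X j.-1] can absorb the term [k j * s j * X j.-1] with the
    fraction [p^-1] to spare. *)
Lemma step_sratio_le j : (2 <= j <= n)%N -> k j * s j <= (2 - p^-1) * k j.-1.
Proof.
move=> jn; have r0 := ratio_gt0 jn; have rR := ratio_le jn.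
have k0 : 0 < k j.-1.
  by apply: step_gt0; case: j jn {r0 rR} => [//|[//|j]] /ltnW.
have -> : k j * s j = (r j ^+ 2 / (1 + r j)) * k j.-1.
  rewrite /sratio /Defs.ratio; field; rewrite !gt_eqF //.
  by apply: addr_gt0 => //; apply: step_gt0; case/andP: jn => /ltnW -> ->.
rewrite ler_pM2r // ler_pdivrMr ?addr_gt0 //.
have -> : p^-1 = 1 - Num.sqrt 2 / 2.
  have p0 : p != 0 by rewrite gt_eqF //; move: sqrt2_gt1; lra.
  by field: sqrt2_sq.
have -> : r j ^+ 2 = (2 - (1 - Num.sqrt 2 / 2)) * (1 + r j) -
   (Num.sqrt 2 + 1 - r j) * (r j + Num.sqrt 2 / 2) by field: sqrt2_sq.
by move: Rr_lt sqrt2_gt1 => ? ?; rewrite gerBl mulr_ge0 //; lra.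
Qed.

(** [s j] is at most [Rr / (1 + Rr)], whose square is the right-hand side by the formula for [c3].
    The case [j = 1] is included because the summation by parts reaches [s m.-1] with [m = 2]. *)
Lemma sratio_sqr_le j : (1 <= j <= n)%N -> s j ^+ 2 <= (1 - c3^-1) / 2.
Proof.
move: Rr1 Rr_quad => R1 Rq.
have -> : (1 - c3^-1) / 2 = (Rr / (1 + Rr)) ^+ 2.
  by rewrite /c3; field; rewrite !gt_eqF //; lra.
have R0 : 0 <= Rr / (1 + Rr) by rewrite divr_ge0; lra.
case: j => [//|[|j]] jn; first by rewrite sratio1 expr0n sqr_ge0.
rewrite lerXn2r ?nnegrE ?sratio_ge0 //.
have r0 := ratio_gt0 (j := j.+2) jn; have rR := ratio_le (j := j.+2) jn.
rewrite /sratio ler_pdivrMr; last by rewrite addr_gt0.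
rewrite mulrAC ler_pdivlMr; last by rewrite addr_gt0 // (lt_trans _ R1).
by move: r0 rR; set x := Defs.ratio t _ => r0 rR; lra.
Qed.

Lemma c3_gt1 : 1 < c3.
Proof. by move: Rr1 => ?; rewrite /c3 ltr_pdivlMr //; nra. Qed.

(** From [s j ^+ 2 < 1 / 2 < (3 / 4) ^+ 2]. It leaves [1 - s j >= 1 / 4], the share of the
    dissipation kept in the energy inequality. *)
Lemma sratio_le j : (1 <= j <= n)%N -> s j <= 3 / 4.
Proof.
move=> jn; have s2 := sratio_sqr_le jn.
have c0 : 0 < c3^-1 by rewrite invr_gt0 (lt_trans _ c3_gt1).
rewrite leNgt; apply/negP => s3.
have : (3 / 4) ^+ 2 < s j ^+ 2 by rewrite ltrXn2r ?nnegrE //; lra.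
lra.
Qed.

(** This brings in [Phi]: the difference of squares factors as [(s j + s j.+2) * (r j - r j.+2)]
    divided by [(1 + r j) * (1 + r j.+2)], where the first factor is below 2 and the divisor above
    1. *)
Lemma pos_part_sratio_le j : (2 <= j)%N -> (j.+2 <= n)%N ->
  pos_part (s j ^+ 2 - s j.+2 ^+ 2) <= 2 * pos_part (r j - r j.+2).
Proof.
move=> j2 jn; have jn' : (2 <= j <= n)%N by rewrite j2 ltnW // ltnW.
have r0 := ratio_gt0 jn'; have r20 := ratio_gt0 (j := j.+2) jn.
apply: pos_part_le; first by rewrite mulr_ge0 ?pos_part_ge0.
have e : s j ^+ 2 - s j.+2 ^+ 2 =
    (s j + s j.+2) * ((r j - r j.+2) * ((1 + r j)^-1 * (1 + r j.+2)^-1)).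
  by rewrite /sratio; field; rewrite !gt_eqF ?addr_gt0.
have s0 := sratio_ge0 (ltnW (ltnW jn)); have s20 := sratio_ge0 jn.
have s1 : s j <= 3 / 4 by rewrite sratio_le // (ltnW j2) ltnW // ltnW.
have s21 : s j.+2 <= 3 / 4 by rewrite sratio_le.
have i0 : 0 <= (1 + r j)^-1 * (1 + r j.+2)^-1.
  by rewrite mulr_ge0 // invr_ge0 addr_ge0 // ltW.
have i1 : (1 + r j)^-1 * (1 + r j.+2)^-1 <= 1.
  by rewrite mulr_ile1 ?invr_ge0 ?invf_le1 ?lerDl ?addr_gt0 ?addr_ge0 ?ltW.
rewrite e.
have P0 := pos_part_ge0 (r j - r j.+2).
apply: (@le_trans _ _ ((s j + s j.+2) * pos_part (r j - r j.+2))).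
  rewrite ler_wpM2l ?addr_ge0 //.
  apply: (@le_trans _ _ (pos_part (r j - r j.+2) *
     ((1 + r j)^-1 * (1 + r j.+2)^-1))).
    by rewrite ler_wpM2r // le_pos_part.
  by rewrite ler_piMr.
by rewrite ler_wpM2r //; lra.
Qed.

Lemma t_ge0 j : (j <= n)%N -> 0 <= t j.
Proof.
elim: j => [|j IH] jn; first by rewrite t0.
by rewrite ltW // (le_lt_trans (IH (ltnW jn))) // t_lt.
Qed.

Lemma t_le j m : (j <= m)%N -> (m <= n)%N -> t j <= t m.
Proof.
elim: m => [|m IH]; first by rewrite leqn0 => /eqP ->.
rewrite leq_eqVlt => /predU1P[-> //|jm] mn.
by rewrite (le_trans (IH jm (ltnW mn))) // ltW // t_lt.
Qed.

Lemma sum_step_le m : (m <= n)%N -> \sum_(2 <= j < m.+1) k j <= t n.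
Proof.
case: m => [|m] mn; first by rewrite big_geq // t_ge0.
have -> : \sum_(2 <= j < m.+2) k j = t m.+1 - t 1%N.
  by rewrite big_add1 /= /step /= telescope_sumr.
by rewrite lerBlDr (le_trans (t_le mn (leqnn n))) // lerDl t_ge0 // (leq_trans _ mn).
Qed.

Lemma step_le_t j : (1 <= j <= n)%N -> k j <= t n.
Proof.
case: j => [//|j] /andP[_ jn]; rewrite /step /= lerBlDr.
by rewrite (le_trans (t_le jn (leqnn n))) // lerDl t_ge0 // ltnW.
Qed.

(** * Summed bound for the difference quotients, [X j] standing for |x^j|^2 and [Y j] for
    ||e^j||^2 *)

Section Energy.
Variables (X Y : nat -> R).
Hypotheses (X0 : forall j, 0 <= X j)
  (Y0 : forall j, 0 <= Y j).

Lemma difference_energy_sum (gY D : R) :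
  (forall j, (2 <= j <= n)%N ->
     k j * (2 + s j) * X j - k j * s j * X j.-1 + Y j - Y j.-1 <=
     7 / 8 * p^-1 * (k j * X j) + gY * (k j * Y j) + 8 * p * (k j * D)) ->
  forall m, (2 <= m <= n)%N ->
    Y m + p^-1 / 8 * \sum_(2 <= j < m.+1) k j * X j <=
    Y 1%N + k 2%N * X 1%N + \sum_(2 <= j < m.+1) gY * k j * Y j
    + 8 * p * D * \sum_(2 <= j < m.+1) k j.
Proof.
move=> HI m /andP[m2 mn].
have p0 : 0 < p^-1 by rewrite invr_gt0; move: sqrt2_gt1; lra.
have skX j : (2 <= j <= n)%N -> 0 <= k j * X j.
  by move=> /andP[j2 jn]; rewrite mulr_ge0 // ltW // step_gt0 // jn (ltnW j2).
have sX j : (2 <= j <= n)%N -> 0 <= k j * s j * X j.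
  move=> jn; rewrite mulrAC mulr_ge0 ?skX //; apply: sratio_ge0.
  by case/andP: jn.
(* The induction carries the extra term [(2 - p^-1) * (k m * X m)], which pays for the negative term
   in [X m] of the next step. Its coefficient is what remains of 2 after [7 / 8 * p^-1] for the
   right-hand side and [p^-1 / 8] for the sum. *)
suff : Y m + p^-1 / 8 * (\sum_(2 <= j < m.+1) k j * X j)
    + (2 - p^-1) * (k m * X m) <=
    Y 1%N + k 2%N * X 1%N + \sum_(2 <= j < m.+1) gY * k j * Y j
    + 8 * p * D * \sum_(2 <= j < m.+1) k j.
  apply: le_trans; rewrite lerDl mulr_ge0 ?skX ?m2 //.
  have p1 : 1 < p by move: sqrt2_gt1; lra.
  by rewrite subr_ge0 (@le_trans _ _ 1) ?ler1n // invf_le1 ?ltW // (lt_trans _ p1).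
elim: m m2 mn => [//|m IH] m2 mn.
have mn2 : (2 <= m.+1 <= n)%N by rewrite m2 mn.
have /= HI1 := HI _ mn2; have sX1 := sX _ mn2.
rewrite ![\sum_(2 <= j < m.+2) _]big_nat_recr //=.
move: m2; rewrite leq_eqVlt => /predU1P[m1|m2].
  case: m1 => m1; move: HI1 sX1 mn mn2; rewrite -{}m1 !big_geq //= => HI1 sX1 mn mn2.
  (* No earlier step can absorb [X 1], so it stays in the bound as a starting value. *)
  have : k 2%N * s 2%N * X 1%N <= k 2%N * X 1%N.
    rewrite ler_wpM2r // ler_piMr ?ltW ?step_gt0 //.
    by have := sratio_le (j := 2) mn; lra.
  lra.
have := IH m2 (ltnW mn).
have := ler_wpM2r (X0 m) (step_sratio_le mn2).
move=> /=; lra.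
Qed.

(** Gronwall's lemma is first applied to [Y], with the sum of the [X j] dropped: [gY * k m <= 2 / 3]
    leaves the factor [1 / 3] in front of [Y m]. The resulting bound on [Y] is then inserted to
    control the sum of the [X j]. *)
Lemma difference_energy (gY D : R) :
  0 <= gY -> 0 <= D -> (forall j, (2 <= j <= n)%N -> gY * k j <= 2 / 3) ->
  (forall j, (2 <= j <= n)%N ->
     k j * (2 + s j) * X j - k j * s j * X j.-1 + Y j - Y j.-1 <=
     7 / 8 * p^-1 * (k j * X j) + gY * (k j * Y j) + 8 * p * (k j * D)) ->
  forall m, (2 <= m <= n)%N ->
    \sum_(2 <= j < m.+1) k j * X j <=
    8 * p * (1 + 3 * gY * t n * expR (3 * gY * t n)) *
      (Y 1%N + k 2%N * X 1%N + 8 * p * D * t n).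
Proof.
move=> gY0 D0 gYk HI m mn.
have p0 : 0 < p by move: sqrt2_gt1; lra.
have k0 j : (2 <= j <= n)%N -> 0 <= k j.
  by case/andP=> j2 jn; rewrite ltW // step_gt0 // jn (ltnW j2).
have HS := difference_energy_sum HI.
have n2 : (2 <= n)%N by case/andP: mn => /leq_trans h /h.
set F := Y 1%N + k 2%N * X 1%N + 8 * p * D * t n.
have pDt m' : (m' <= n)%N ->
    8 * p * D * \sum_(2 <= j < m'.+1) k j <= 8 * p * D * t n.
  by move=> ?; rewrite ler_wpM2l ?sum_step_le // !mulr_ge0 // ltW.
have k2X : 0 <= k 2%N * X 1%N by rewrite mulr_ge0 // k0.
have pDt0 : 0 <= 8 * p * D * t n by rewrite !mulr_ge0 ?t_ge0 // ltW.
have F0 : 0 <= F by rewrite /F; have := Y0 1%N; lra.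
have skX m' : (m' <= n)%N -> 0 <= \sum_(2 <= j < m'.+1) k j * X j.
  move=> mn'; apply: sum_nat_ge0 => j /andP[j2 jm].
  by rewrite mulr_ge0 // k0 // j2 (leq_trans _ mn').
have sumw m' : (m' <= n)%N -> \sum_(2 <= j < m'.+1) gY * k j <= gY * t n.
  by move=> mn'; rewrite -mulr_sumr ler_wpM2l // sum_step_le.
have YG j : (2 <= j <= n)%N -> Y j <= 3 * F * expR (3 * gY * t n).
  move=> /andP[j2 jn].
  apply: (@le_trans _ _ (F / 3^-1 * expR ((\sum_(2 <= i < j) gY * k i) / 3^-1))).
    apply: (@discrete_gronwall _ 3^-1 0 F (fun i => gY * k i) Y n) => //.
    - by move=> i /andP[i2 ii]; rewrite mulr_ge0 // k0 // i2 ltnW.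
    - by rewrite invrK /F; have := Y0 1%N; lra.
    - move=> m' mn'; have /andP[m2' mn2'] := mn'.
      have := HS _ mn'; rewrite [\sum_(_ <= j < _) gY * _ * _]big_nat_recr //=.
      have := ler_wpM2r (Y0 m') (gYk _ mn'); have := pDt _ mn2'.
      have : 0 <= p^-1 / 8 * \sum_(2 <= j0 < m'.+1) k j0 * X j0.
        by rewrite mulr_ge0 ?skX // divr_ge0 // invr_ge0 ltW.
      by rewrite /F; lra.
    - by rewrite jn (ltnW j2).
  rewrite !invrK [F * 3]mulrC ler_wpM2l ?mulr_ge0 // ler_expR mulrC -mulrA.
  rewrite ler_wpM2l //; case: j j2 jn => [//|j] j2 jn; exact: sumw (ltnW jn).
have /andP[m2 mn2] := mn.
have sY : \sum_(2 <= j < m.+1) gY * k j * Y j <=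
    3 * gY * t n * expR (3 * gY * t n) * F.
  apply: (@le_trans _ _
     (\sum_(2 <= j < m.+1) gY * k j * (3 * F * expR (3 * gY * t n)))).
    apply: ler_sum_nat_in => j /andP[j2 jm].
    have jn : (2 <= j <= n)%N by rewrite j2 (leq_trans _ mn2).
    by rewrite ler_wpM2l ?mulr_ge0 ?k0 ?YG.
  rewrite -mulr_suml.
  have -> : 3 * gY * t n * expR (3 * gY * t n) * F =
    gY * t n * (3 * F * expR (3 * gY * t n)) by ring.
  by rewrite ler_wpM2r ?sumw // !mulr_ge0 // expR_ge0.
have H : p^-1 / 8 * \sum_(2 <= j < m.+1) k j * X j <=
    (1 + 3 * gY * t n * expR (3 * gY * t n)) * F.
  by have := HS _ mn; have := pDt _ mn2; have := Y0 m; rewrite /F in sY *; lra.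
have -> : \sum_(2 <= j < m.+1) k j * X j =
   8 * p * (p^-1 / 8 * \sum_(2 <= j < m.+1) k j * X j).
  by field; rewrite gt_eqF.
by rewrite -[leRHS]mulrA ler_wpM2l // mulr_ge0 // ltW.
Qed.

End Energy.

(** * Gronwall argument for the energy inequality with lag two *)

Section Stability.
Variables (E Y z : nat -> R) (h D P : R).
Hypotheses (E_ge0 : forall j, 0 <= E j) (Y_ge0 : forall j, 0 <= Y j).
Hypotheses (h0 : 0 <= h) (D0 : 0 <= D) (P0 : 0 <= P).
Hypothesis n2 : (2 <= n)%N.
Hypothesis hk : forall j, (2 <= j <= n)%N -> h * k j <= 5 / 8 * c3^-1.
Hypothesis sum_z :
  forall m, (2 <= m <= n)%N -> \sum_(2 <= j < m.+1) z j <= P.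
Hypothesis energy_step : forall j, (2 <= j <= n)%N ->
  E j - E j.-1 - s j ^+ 2 * (E j - E j.-2) + k j / 4 * Y j <=
  z j + h * (k j * E j) + k j * D.

Let F := E 1%N + P + D * t n.
Let W := 2 * Phi t n + h * t n.
Let K := 8 / 3 * c3 * expR (8 / 3 * c3 * W).
(** A weight that does not change with [m], as Gronwall's lemma demands; it is cut off where [j.+2]
    would exceed [n], since the ratios are controlled only up to [n]. *)
Let phi j : R :=
  if (j < n.-1)%N then pos_part (s j ^+ 2 - s j.+2 ^+ 2) else 0.

Let phi_ge0 j : 0 <= phi j.
Proof. by rewrite /phi; case: ifP => // _; exact: pos_part_ge0. Qed.

Let k0 j : (2 <= j <= n)%N -> 0 <= k j.
Proof. by case/andP=> j2 jn; rewrite ltW // step_gt0 // jn (ltnW j2). Qed.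

Let sum_phi m : (m <= n)%N -> \sum_(2 <= j < m) phi j <= 2 * Phi t n.
Proof.
move=> mn; apply: (@le_trans _ _ (\sum_(2 <= j < n) phi j)).
  exact: ler_sum_nat_widen.
rewrite /phi -big_mkcond -(big_nat_widen _ _ _ xpredT) ?leq_pred //=.
rewrite /Phi mulr_sumr; apply: ler_sum_nat_in => j /andP[j2 jn].
by apply: pos_part_sratio_le => //; rewrite -ltn_predRL.
Qed.

(** The first differences telescope and [sum_lag2_le] treats the others. The boundary weight
    [s m.-1 ^+ 2] is replaced by its uniform bound, to serve as the constant [b] in Gronwall's
    lemma. *)
Let energy_sum m : (2 <= m <= n)%N ->
  (1 - s m ^+ 2) * E m + 4^-1 * \sum_(2 <= j < m.+1) k j * Y j <=
  (1 - c3^-1) / 2 * E m.-1 + \sum_(2 <= j < m) phi j * E j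
  + \sum_(2 <= j < m.+1) h * k j * E j + F.
Proof.
move=> mn; have /andP[m2 mn2] := mn.
have HS : \sum_(2 <= j < m.+1)
    (E j - E j.-1 - s j ^+ 2 * (E j - E j.-2) + k j / 4 * Y j) <=
   \sum_(2 <= j < m.+1) (z j + h * (k j * E j) + k j * D).
  apply: ler_sum_nat_in => j /andP[j2 jm]; apply: energy_step.
  by rewrite j2 (leq_trans _ mn2).
have tele : \sum_(2 <= j < m.+1) (E j - E j.-1) = E m - E 1%N.
  case: m m2 {mn mn2 HS} => [//|m] m2.
  by rewrite big_add1 /= telescope_sumr.
have lag : \sum_(2 <= j < m.+1) s j ^+ 2 * (E j - E j.-2) <=
    s m ^+ 2 * E m + s m.-1 ^+ 2 * E m.-1
    + \sum_(2 <= j < m.-1) pos_part (s j ^+ 2 - s j.+2 ^+ 2) * E j.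
  apply: (@sum_lag2_le _ (fun j => s j ^+ 2)) => //.
    by rewrite sratio1 expr0n.
  by move=> j; exact: sqr_ge0.
have lag_phi : \sum_(2 <= j < m.-1) pos_part (s j ^+ 2 - s j.+2 ^+ 2) * E j <=
    \sum_(2 <= j < m) phi j * E j.
  apply: (@le_trans _ _ (\sum_(2 <= j < m.-1) phi j * E j)).
    apply: ler_sum_nat_in => j /andP[j2 jm].
    rewrite /phi (leq_trans jm) //; case: m m2 mn2 {jm HS tele lag mn} => //= m.
    by move=> _ mn; rewrite -ltnS prednK // ltnW.
  apply: ler_sum_nat_widen; first exact: leq_pred.
  by move=> j _; rewrite mulr_ge0.
have sE : s m.-1 ^+ 2 * E m.-1 <= (1 - c3^-1) / 2 * E m.-1.
  rewrite ler_wpM2r // sratio_sqr_le //.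
  by case: m m2 mn2 {mn HS tele lag lag_phi} => [//|m] /= m2 /ltnW ->; rewrite -ltnS m2.
have Dt : \sum_(2 <= j < m.+1) k j * D <= D * t n.
  by rewrite -mulr_suml mulrC ler_wpM2l // sum_step_le.
have e1 : \sum_(2 <= j < m.+1) k j / 4 * Y j =
   4^-1 * \sum_(2 <= j < m.+1) k j * Y j.
  by rewrite mulr_sumr; apply: eq_bigr => j _; ring.
have e2 : \sum_(2 <= j < m.+1) h * (k j * E j) =
   \sum_(2 <= j < m.+1) h * k j * E j.
  by apply: eq_bigr => j _; ring.
move: HS tele; rewrite !big_split /= !sumrN e1 e2.
have := sum_z mn; rewrite /F; lra.
Qed.

Let c30 : 0 < c3. Proof. exact: lt_trans c3_gt1. Qed.

Let F0 : 0 <= F.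
Proof. by rewrite /F !addr_ge0 // mulr_ge0 // t_ge0. Qed.

Lemma energy_bound m : (1 <= m <= n)%N -> E m <= K * F.
Proof.
(* With [b = (1 - c3^-1) / 2] one has [a + b = 1 / 2 - c3^-1 / 8], exactly the lower bound for
   [1 - s m ^+ 2 - h * k m] that [sratio_sqr_le] and [hk] provide. *)
move=> mn; pose w j := phi j + h * k j; pose a : R := 3 / 8 * c3^-1.
have ci : 0 < c3^-1 by rewrite invr_gt0.
have ci1 : c3^-1 < 1 by rewrite invf_lt1 // c3_gt1.
have a0 : 0 < a by rewrite mulr_gt0.
have aI : a^-1 = 8 / 3 * c3 by rewrite /a; field; rewrite gt_eqF.
have c83 : 0 <= 8 / 3 * c3 by rewrite -aI invr_ge0 ltW.
have w0 j : (2 <= j < n)%N -> 0 <= w j.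
  by move=> /andP[j2 jn]; rewrite addr_ge0 // mulr_ge0 // k0 // j2 ltnW.
apply: (@le_trans _ _ (F / a * expR ((\sum_(2 <= j < m) w j) / a))); last first.
  rewrite aI /K [leRHS]mulrAC [F * _]mulrC ler_wpM2l //; first exact: mulr_ge0.
  rewrite ler_expR mulrC ler_wpM2l //.
  rewrite big_split /= lerD ?sum_phi //; first by case/andP: mn.
  rewrite -mulr_sumr ler_wpM2l //.
  case: m mn => [//|m] /andP[_ mn]; exact: sum_step_le (ltnW mn).
apply: (@discrete_gronwall _ a ((1 - c3^-1) / 2) F w E n) => //.
- by rewrite divr_ge0 // subr_ge0 ltW.
- rewrite aI; apply: (@le_trans _ _ F).
    by rewrite /F -addrA lerDl addr_ge0 // mulr_ge0 // t_ge0.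
  by rewrite ler_peMr //; have := c3_gt1; lra.
move=> m' mn'; have /andP[m2 mn2] := mn'.
have := energy_sum mn'; rewrite [\sum_(_ <= j < _) h * _ * _]big_nat_recr //=.
have -> : \sum_(2 <= j < m') w j * E j =
   \sum_(2 <= j < m') phi j * E j + \sum_(2 <= j < m') h * k j * E j.
  by rewrite -big_split; apply: eq_bigr => j _; rewrite /w mulrDl.
have := ler_wpM2r (E_ge0 m') (hk mn').
have := ler_wpM2r (E_ge0 m') (sratio_sqr_le (j := m') _).
rewrite (ltnW m2) mn2 => /(_ isT).
have : 0 <= \sum_(2 <= j < m'.+1) k j * Y j.
  apply: sum_nat_ge0 => j /andP[j2 jm].
  by rewrite mulr_ge0 // k0 // j2 (leq_trans _ mn2).
rewrite /a; lra.
Qed.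

(** In [energy_sum] at [m = n], every [E j] on the right is replaced by its bound [K * F]; the
    coefficients add up to at most [1 + W]. *)
Lemma dissipation_bound :
  \sum_(2 <= j < n.+1) k j * Y j <= 4 * (F + (1 + W) * (K * F)).
Proof.
have nn : (2 <= n <= n)%N by rewrite n2 leqnn.
have := energy_sum nn.
have KF j : (2 <= j <= n)%N -> E j <= K * F.
  by case/andP=> j2 jn; apply: energy_bound; rewrite jn (ltnW j2).
have KF0 : 0 <= K * F.
  by rewrite mulr_ge0 // mulr_ge0 ?expR_ge0 // mulr_ge0 // ltW.
have ci : 0 < c3^-1 by rewrite invr_gt0.
have : (1 - c3^-1) / 2 * E n.-1 <= K * F.
  apply: (@le_trans _ _ (E n.-1)); first by rewrite ler_piMl //; lra.
  by apply: energy_bound; rewrite leq_pred andbT -ltnS prednK // ltnW.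
have : 0 <= (1 - s n ^+ 2) * E n.
  rewrite mulr_ge0 // subr_ge0.
  have := sratio_sqr_le (j := n); rewrite leqnn (ltnW n2) => /(_ isT); lra.
have : \sum_(2 <= j < n) phi j * E j <= 2 * Phi t n * (K * F).
  apply: (@le_trans _ _ (\sum_(2 <= j < n) phi j * (K * F))).
    apply: ler_sum_nat_in => j /andP[j2 jn].
    by rewrite ler_wpM2l // KF // j2 ltnW.
  by rewrite -mulr_suml ler_wpM2r // sum_phi.
have : \sum_(2 <= j < n.+1) h * k j * E j <= h * t n * (K * F).
  apply: (@le_trans _ _ (\sum_(2 <= j < n.+1) h * k j * (K * F))).
    apply: ler_sum_nat_in => j jn.
    by rewrite ler_wpM2l ?KF // mulr_ge0 // k0.
  by rewrite -mulr_suml ler_wpM2r // -mulr_sumr ler_wpM2l // sum_step_le.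
rewrite /W; lra.
Qed.

End Stability.

(** * Explicit constants and the combined stability estimate *)

Definition difference_const (g tn : R) : R :=
  let gY := 4 / 3 * p * g ^+ 2 in
  8 * p * (1 + 3 * gY * tn * expR (3 * gY * tn)).

(** Factor between the Gronwall datum [F] and the starting data. The 2 counts [E 1] twice: as
    initial energy and as the first term of the sum of the [z j]. *)
Definition data_const (g c c4 tn : R) : R :=
  2 + difference_const g tn
  + (8 * p * difference_const g tn + 8 * c) * (c4 ^+ 2 * tn ^+ 2).

(** In the last factor, [K] comes from [energy_bound] and the rest from [dissipation_bound]. *)
Definition stability_const (g c c4 tn Ph : R) : R :=
  let W := 2 * Ph + (g ^+ 2 + (8 * c * tn)^-1) * tn in
  let K := 8 / 3 * c * expR (8 / 3 * c * W) in
  data_const g c c4 tn * (K + 4 * (1 + (1 + W) * K)).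

Lemma difference_const_ge0 g tn : 0 <= tn -> 0 <= difference_const g tn.
Proof.
move=> tn0; have p0 : 0 <= p by move: sqrt2_gt1; lra.
have gY0 : 0 <= 4 / 3 * p * g ^+ 2.
  by rewrite mulr_ge0 ?sqr_ge0 // mulr_ge0.
rewrite /difference_const /=; move: (4 / 3 * p * g ^+ 2) gY0 => gY gY0.
apply: mulr_ge0; first by rewrite mulr_ge0.
by rewrite addr_ge0 // !mulr_ge0 // expR_ge0.
Qed.

Lemma Phi_ge0 : 0 <= Phi t n.
Proof. by apply: sum_nat_ge0 => j _; exact: pos_part_ge0. Qed.

Lemma stability_const_ge0 g c4 tn Ph :
  0 <= tn -> 0 <= Ph -> 0 <= stability_const g c3 c4 tn Ph.
Proof.
move=> tn0 Ph0; have c0 : 0 <= c3 by rewrite ltW // (lt_trans _ c3_gt1).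
have K10 := difference_const_ge0 g tn0.
have p0 : 0 <= p by move: sqrt2_gt1; lra.
have F0 : 0 <= data_const g c3 c4 tn.
  rewrite /data_const; apply: addr_ge0; first exact: addr_ge0.
  apply: mulr_ge0; last by rewrite mulr_ge0 ?sqr_ge0.
  by apply: addr_ge0; rewrite mulr_ge0 // mulr_ge0.
have W0 : 0 <= 2 * Ph + (g ^+ 2 + (8 * c3 * tn)^-1) * tn.
  apply: addr_ge0; first by rewrite mulr_ge0.
  by rewrite mulr_ge0 // addr_ge0 ?sqr_ge0 // invr_ge0 mulr_ge0 // mulr_ge0.
rewrite /stability_const /=; move: (_ + _ * tn) W0 => W W0.
have K0 : 0 <= 8 / 3 * c3 * expR (8 / 3 * c3 * W).
  by rewrite mulr_ge0 ?expR_ge0 // mulr_ge0.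
rewrite mulr_ge0 // addr_ge0 // mulr_ge0 // addr_ge0 // mulr_ge0 //.
exact: addr_ge0.
Qed.

(** The two arguments are chained: [difference_energy] bounds the sum of [k j * X j], and [kap]
    times this bound controls the terms [k j.-1 ^+ 2 * X j.-1] that drive the inequality for [E]. A
    common bound [M] stands in for the maximum norm. *)
Lemma bdf2_stability (E X Y : nat -> R) (g c4 kap : R) :
  (forall j, 0 <= E j) -> (forall j, 0 <= X j) -> (forall j, 0 <= Y j) ->
  k 1%N ^+ 2 * X 1%N = E 1%N ->
  (2 <= n)%N -> (forall j, (2 <= j <= n)%N -> k j <= kap) -> kap <= t n ->
  (4 + 2 * Num.sqrt 2) * g ^+ 2 * kap <= 1 -> 2 * c3 * g ^+ 2 * kap <= 1 ->
  (forall j, (2 <= j <= n)%N ->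
     k j * (2 + s j) * X j - k j * s j * X j.-1 + Y j - Y j.-1 <=
     7 / 8 * p^-1 * (k j * X j) + 4 / 3 * p * g ^+ 2 * (k j * Y j)
     + 8 * p * (k j * (c4 ^+ 2 * kap ^+ 4))) ->
  (forall j, (2 <= j <= n)%N ->
     E j - E j.-1 - s j ^+ 2 * (E j - E j.-2) + k j / 4 * Y j <=
     k j.-1 ^+ 2 * X j.-1 + (g ^+ 2 + (8 * c3 * t n)^-1) * (k j * E j)
     + k j * (c4 ^+ 2 * kap ^+ 4 / (8 * c3 * t n)^-1)) ->
  exists2 M, (forall j, (2 <= j <= n)%N -> E j <= M)
    & M + \sum_(2 <= j < n.+1) k j * Y j <=
      stability_const g c3 c4 (t n) (Phi t n) *
      (E 1%N + kap * Y 1%N + kap * k 2%N / k 1%N ^+ 2 * E 1%N + kap ^+ 4).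
Proof.
move=> E_ge0 X_ge0 Y_ge0 EX n2 kkap kapt gk1 gk2 H1 H2.
set D := c4 ^+ 2 * kap ^+ 4 in H1 H2.
have k0 j : (2 <= j <= n)%N -> 0 < k j.
  by case/andP=> j2 jn; rewrite step_gt0 // jn (ltnW j2).
have kap0 : 0 < kap by apply: (lt_le_trans (k0 2%N _) (kkap 2%N _)); rewrite n2.
have tn0 : 0 < t n := lt_le_trans kap0 kapt.
have c31 := c3_gt1; have c30 : 0 < c3 by rewrite (lt_trans _ c31).
have p0 : 0 < p by move: sqrt2_gt1; lra.
have g2 := sqr_ge0 g.
have D0 : 0 <= D by rewrite mulr_ge0 ?sqr_ge0 // exprn_ge0 // ltW.
set K1 := difference_const g (t n).
have K10 : 0 <= K1 by apply: difference_const_ge0; exact: ltW.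
have k1X : k 2%N * X 1%N = k 2%N / k 1%N ^+ 2 * E 1%N.
  have k1 : k 1%N != 0 by rewrite gt_eqF // step_gt0 // (ltnW n2).
  by rewrite -EX; field.
set F1 := Y 1%N + k 2%N * X 1%N + 8 * p * D * t n.
have SX : \sum_(2 <= j < n.+1) k j * X j <= K1 * F1.
  apply: (difference_energy X_ge0 Y_ge0 _ D0 _ H1); rewrite ?n2 ?leqnn //.
    by rewrite mulr_ge0 // mulr_ge0 // ltW.
  (* [gk1] reads [2 * p * g ^+ 2 * kap <= 1], so [4 / 3 * p * g ^+ 2 * k j <= 2 / 3]. *)
  move=> j jn.
  have : g ^+ 2 * k j <= g ^+ 2 * kap by rewrite ler_wpM2l ?kkap.
  move=> /(ler_wpM2l (ltW p0)); lra.
set P := E 1%N + kap * (K1 * F1).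
have SX0 : 0 <= K1 * F1.
  apply: le_trans SX; apply: sum_nat_ge0 => j jn.
  by rewrite mulr_ge0 // ltW // k0.
have P0 : 0 <= P by rewrite addr_ge0 // mulr_ge0 // ltW.
(* The first term is [k 1 ^+ 2 * X 1 = E 1]; it is split off because [kap] does not bound [k 1]. *)
have SZ m : (2 <= m <= n)%N ->
    \sum_(2 <= j < m.+1) k j.-1 ^+ 2 * X j.-1 <= P.
  move=> /andP[m2 mn]; rewrite big_add1 /= big_ltn // EX lerD2l.
  apply: le_trans (ler_wpM2l (ltW kap0) SX); rewrite mulr_sumr.
  apply: (@le_trans _ _ (\sum_(2 <= j < m) kap * (k j * X j))).
    apply: ler_sum_nat_in => j /andP[j2 jm].
    have jn : (2 <= j <= n)%N by rewrite j2 (leq_trans (ltnW jm)).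
    by rewrite mulrA expr2 ler_wpM2r // ler_wpM2r ?kkap // ltW // k0.
  apply: ler_sum_nat_widen => [|j jn]; first exact: leqW.
  by rewrite !mulr_ge0 // ltW // k0.
(* Chosen so that [eps * t n = c3^-1 / 8]: added to the bound [c3^-1 / 2] for [g ^+ 2 * k j], this
   gives the [5 / 8 * c3^-1] of [hk]. *)
set eps := (8 * c3 * t n)^-1 in H2 *.
have eps0 : 0 < eps by rewrite invr_gt0 mulr_gt0 // mulr_gt0.
have h0 : 0 <= g ^+ 2 + eps by rewrite addr_ge0 // ltW.
have hk j : (2 <= j <= n)%N -> (g ^+ 2 + eps) * k j <= 5 / 8 * c3^-1.
  move=> jn; have kj := kkap _ jn.
  have a1 : g ^+ 2 * k j <= c3^-1 / 2.
    rewrite ler_pdivlMr // -(ler_pM2l c30) mulfV ?gt_eqF //.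
    have := ler_wpM2l (ltW c30) (ler_wpM2l g2 kj); lra.
  have a2 : eps * k j <= c3^-1 / 8.
    apply: (@le_trans _ _ (eps * t n)).
      by rewrite ler_wpM2l ?(ltW eps0) ?(le_trans kj kapt).
    by rewrite /eps le_eqVlt; apply/orP; left; apply/eqP; field; rewrite !gt_eqF.
  lra.
have De0 : 0 <= D / eps by rewrite divr_ge0 // ltW.
have EB := @energy_bound E Y _ _ _ P E_ge0 Y_ge0 h0 De0 P0 n2 hk SZ H2.
have DB := @dissipation_bound E Y _ _ _ P E_ge0 Y_ge0 h0 De0 P0 n2 hk SZ H2.
set W := 2 * Phi t n + (g ^+ 2 + eps) * t n in EB DB.
set K := 8 / 3 * c3 * expR (8 / 3 * c3 * W) in EB DB.
set F := E 1%N + P + D / eps * t n in EB DB.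
exists (K * F).
  by move=> j /andP[j2 jn]; apply: EB; rewrite jn (ltnW j2).
set Q := E 1%N + kap * Y 1%N + _ + _.
have Q4 : D / eps * t n = 8 * c3 * (c4 ^+ 2 * t n ^+ 2) * kap ^+ 4.
  by rewrite /eps /D invrK; ring.
have a0 : 0 <= c4 ^+ 2 * t n ^+ 2 by rewrite mulr_ge0 ?sqr_ge0.
have kap4 : 0 <= kap ^+ 4 by rewrite exprn_ge0 // ltW.
have q2 : 0 <= kap * Y 1%N by rewrite mulr_ge0 // ltW.
have q3 : 0 <= kap * k 2%N / k 1%N ^+ 2 * E 1%N.
  by rewrite mulr_ge0 // divr_ge0 ?sqr_ge0 // mulr_ge0 ?ltW ?k0 ?n2.
have Q0 : 0 <= Q by rewrite /Q; have := E_ge0 1%N; lra.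
have kF1 : kap * F1 <= (1 + 8 * p * (c4 ^+ 2 * t n ^+ 2)) * Q.
  (* A fifth power of [kap] arises here; [kap <= t n] reduces it to the fourth. *)
  have Dkap : kap * (8 * p * D * t n) <= 8 * p * (c4 ^+ 2 * t n ^+ 2) * Q.
    have -> : kap * (8 * p * D * t n) =
      8 * p * (c4 ^+ 2 * t n) * (kap ^+ 4 * kap) by rewrite /D; ring.
    have -> : 8 * p * (c4 ^+ 2 * t n ^+ 2) * Q =
      8 * p * (c4 ^+ 2 * t n) * (Q * t n) by ring.
    have k4Q : kap ^+ 4 <= Q by rewrite /Q; have := E_ge0 1%N; lra.
    apply: ler_wpM2l; last by apply: ler_pM => //; exact: ltW.
    by rewrite mulr_ge0 ?(mulr_ge0 _ (ltW p0)) // mulr_ge0 ?sqr_ge0 // ltW.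
  move: Dkap.
  have : kap * (k 2%N * X 1%N) = kap * k 2%N / k 1%N ^+ 2 * E 1%N.
    by rewrite k1X !mulrA.
  have : kap ^+ 4 + E 1%N + kap * Y 1%N + kap * k 2%N / k 1%N ^+ 2 * E 1%N = Q.
    by rewrite /Q; ring.
  have := E_ge0 1%N; rewrite /F1; lra.
have FQ : F <= data_const g c3 c4 (t n) * Q.
  have := ler_wpM2l K10 kF1.
  have E1Q : E 1%N <= Q by rewrite /Q; have := E_ge0 1%N; lra.
  have : 8 * c3 * (c4 ^+ 2 * t n ^+ 2) * kap ^+ 4 <=
      8 * c3 * (c4 ^+ 2 * t n ^+ 2) * Q.
    rewrite ler_wpM2l //; first by rewrite mulr_ge0 // mulr_ge0 // ltW.
    by rewrite /Q; have := E_ge0 1%N; lra.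
  rewrite /F Q4 /P /data_const -/K1; move: E1Q; clearbody Q; lra.
have Phi0 := Phi_ge0.
have W0 : 0 <= W by rewrite /W addr_ge0 ?mulr_ge0 // ltW.
have K0 : 0 <= K.
  by rewrite mulr_ge0 ?expR_ge0 // mulr_ge0 // ltW.
have KW : 0 <= K + 4 * (1 + (1 + W) * K).
  by rewrite addr_ge0 // mulr_ge0 // addr_ge0 // mulr_ge0 // addr_ge0.
have := ler_wpM2l KW FQ.
rewrite /stability_const -/eps -/W -/K; lra.
Qed.

End Grid.
(** * Energy inequalities in the Hilbert space *)

Section Hilbert.
Variables (R : realType) (H : completeNormedModType R).
Variable dot : {dot H for (@idfun R)}.
Hypothesis dotE : induces_norm dot.

Lemma dotC (x y : H) : dot x y = dot y x.
Proof. by rewrite hermC expr0 mul1r. Qed.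

Lemma dotZl (a : R) (x y : H) : dot (a *: x) y = a * dot x y.
Proof. exact: linearZl_LR. Qed.

Lemma dotZr (a : R) (x y : H) : dot x (a *: y) = a * dot x y.
Proof. by rewrite dotC dotZl dotC. Qed.

Lemma dotDl (x y z : H) : dot (x + y) z = dot x z + dot y z.
Proof. exact: linearDl. Qed.

Lemma dotBl (x y z : H) : dot (x - y) z = dot x z - dot y z.
Proof. exact: linearBl. Qed.

Lemma dotBr (x y z : H) : dot x (y - z) = dot x y - dot x z.
Proof. exact: linearBr. Qed.

Lemma dotNl (x y : H) : dot (- x) y = - dot x y.
Proof. exact: linearNl. Qed.

Lemma dot_ge0 (x : H) : 0 <= dot x x.
Proof. by rewrite dotE sqr_ge0. Qed.

Lemma dot_young (eta : R) (x y : H) :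
  0 < eta -> 2 * dot x y <= eta * dot y y + eta^-1 * dot x x.
Proof.
move=> eta0; have := dot_ge0 (eta *: y - x).
rewrite dotBl !dotBr !dotZl !dotZr (dotC y x) => h.
rewrite -(ler_pM2l eta0).
have -> : eta * (eta * dot y y + eta^-1 * dot x x) =
  eta * eta * dot y y + dot x x by field; rewrite gt_eqF.
lra.
Qed.

(** Young's inequality with weight [g ^+ 2]; for [g = 0] the weight degenerates, but then [b = 0].
    Only half of the [2 * dot a a] obtained by testing is spent. *)
Lemma dot_young_bound (g : R) (a b e : H) :
  dot b b <= g ^+ 2 * dot a a ->
  - (2 * dot b e) <= g ^+ 2 * dot e e + dot a a.
Proof.
have [->|g0] := eqVneq g 0.
  rewrite expr0n /= !mul0r add0r dotE => b0.
  have -> : b = 0.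
    by apply/eqP; rewrite -normr_eq0 -sqrf_eq0 eq_le b0 sqr_ge0.
  by rewrite -(scale0r 0) dotZl mul0r mulr0 oppr0 dot_ge0.
have g2 : 0 < g ^+ 2 by rewrite lt_neqAle eq_sym sqrf_eq0 g0 sqr_ge0.
have := dot_young (- b) e g2; rewrite !dotNl (dotC _ (- b)) dotNl opprK.
rewrite -[in X in _ -> X -> _]ler_pdivrMl // mulrN; lra.
Qed.

(* The error equation tested with [2 k x], where [x] is the difference quotient. *)
Lemma difference_step (x xm a c b d : H) (k s g D q : R) :
  0 < k -> 0 <= s -> 0 < q ->
  dot b b <= g ^+ 2 * dot a a -> dot d d <= D ->
  dot ((1 + s) *: x - s *: xm) (k *: x) + dot a (a - c) + dot b (k *: x)
    = dot d (k *: x) ->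
  k * (2 + s) * dot x x - k * s * dot xm xm + dot a a - dot c c <=
  7 / 8 * q * (k * dot x x) + 4 / 3 * q^-1 * g ^+ 2 * (k * dot a a)
  + 8 * q^-1 * (k * D).
Proof.
move=> k0 s0 q0 bg dD.
rewrite dotBl dotBr !dotZr !dotZl => eqn.
(* The shares [3 / 4] for [b] and [1 / 8] for [d] make up the [7 / 8 * q] of the conclusion. *)
have q34 : 0 < 3 / 4 * q by rewrite mulr_gt0.
have q18 : 0 < 1 / 8 * q by rewrite mulr_gt0.
have bx := dot_young (- b) x q34; have dx := dot_young d x q18.
rewrite !dotNl (dotC _ (- b)) dotNl opprK in bx.
have := dot_young xm x ltr01; rewrite invr1 !mul1r => xx.
have := dot_young a c ltr01; rewrite invr1 !mul1r => ac.
have i34 : (3 / 4 * q)^-1 = 4 / 3 * q^-1 by field; rewrite gt_eqF.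
have i18 : (1 / 8 * q)^-1 = 8 * q^-1 by field; rewrite gt_eqF.
rewrite i34 in bx; rewrite i18 in dx.
have qi : 0 < q^-1 by rewrite invr_gt0.
have h1 : 2 * dot d x - 2 * dot b x <=
    7 / 8 * q * dot x x + 4 / 3 * q^-1 * (g ^+ 2 * dot a a) + 8 * q^-1 * D.
  have := ler_wpM2l (ltW qi) bg; have := ler_wpM2l (ltW qi) dD; lra.
have := ler_wpM2l (ltW k0) h1.
have := ler_wpM2l (mulr_ge0 (ltW k0) s0) xx.
lra.
Qed.

(* The error equation tested with [2 k (1 - s) e]: as [(1 - s) k / km = s], the
   weight [1 - s] turns the coefficients of the two- and three-level differences
   of squares into [1] and [s ^+ 2]. *)
Lemma energy_step (e em emm x xm a b d : H) (k km s g D eps : R) :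
  0 < k -> 0 < km -> s = k / km / (1 + k / km) ->
  0 <= s -> s <= 3 / 4 -> s ^+ 2 <= 1 / 2 -> 0 < eps ->
  k *: x = e - em -> km *: xm = em - emm ->
  dot b b <= g ^+ 2 * dot a a -> dot d d <= D ->
  dot ((1 + s) *: x - s *: xm) e + dot a a + dot b e = dot d e ->
  dot e e - dot em em - s ^+ 2 * (dot e e - dot emm emm) + k / 4 * dot a a <=
  km ^+ 2 * dot xm xm + (g ^+ 2 + eps) * (k * dot e e) + k * (D / eps).
Proof.
move=> k0 km0 sE s0 s34 s2 eps0 xE xmE bg dD.
rewrite dotBl !dotZl => eqn.
have kx : k * dot x e = dot e e - dot em e by rewrite -dotZl xE dotBl.
have kxm : km * dot xm e = dot em e - dot emm e by rewrite -dotZl xmE dotBl.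
have ksm : k * (1 - s) * s = km * s ^+ 2.
  by rewrite sE; field; rewrite !gt_eqF // addr_gt0.
have -> : km ^+ 2 * dot xm xm = dot (em - emm) (em - emm).
  by rewrite -xmE dotZl dotZr mulrA expr2.
have main : 2 * (k * (1 - s) * ((1 + s) * dot x e - s * dot xm e)) =
    2 * (dot e e - dot em e) - s ^+ 2 * (2 * (dot e e - dot emm e)).
  have -> : 2 * (k * (1 - s) * ((1 + s) * dot x e - s * dot xm e)) =
    2 * (1 - s ^+ 2) * (k * dot x e) - 2 * (k * (1 - s) * s) * dot xm e by ring.
  have -> : 2 * (k * (1 - s) * s) * dot xm e = 2 * s ^+ 2 * (km * dot xm e).
    by rewrite ksm; ring.
  by rewrite kx kxm; ring.
have be := dot_young_bound e bg.
have de := dot_young d e eps0.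
have Dd : eps^-1 * dot d d <= D / eps by rewrite mulrC ler_pM2r ?invr_gt0.
have ks0 : 0 <= k * (1 - s) by rewrite mulr_ge0 ?ltW //; lra.
have a0 := dot_ge0 a.
have D0 : 0 <= D / eps := divr_ge0 (le_trans (dot_ge0 d) dD) (ltW eps0).
(* The factor [1 - s] lies between [1 / 4] and 1: it is bounded by 1 on the nonnegative [M] and by
   [1 / 4] from below on the dissipation. *)
have h1 : 2 * (k * (1 - s) * (dot d e - dot b e - dot a a)) <=
    k * (g ^+ 2 + eps) * dot e e + k * (D / eps) - k / 4 * dot a a.
  set M := (g ^+ 2 + eps) * dot e e + D / eps.
  have M0 : 0 <= M.
    by rewrite addr_ge0 // mulr_ge0 ?dot_ge0 // addr_ge0 ?sqr_ge0 ?ltW.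
  have : 2 * (dot d e - dot b e - dot a a) <= M - dot a a by rewrite /M; lra.
  move=> /(ler_wpM2l ks0).
  have : k * (1 - s) * M <= k * M.
    by rewrite ler_wpM2r // ler_piMr ?(ltW k0) //; lra.
  have : k / 4 * dot a a <= k * (1 - s) * dot a a.
    by rewrite ler_wpM2r // ler_wpM2l ?(ltW k0) //; lra.
  rewrite /M; lra.
(* Completing squares in [main] leaves [|e - em|^2 - s ^+ 2 * |e - emm|^2]. By [par] and
   [s ^+ 2 <= 1 / 2] this is at least [- |em - emm|^2], the term in [xm] on the right. *)
have par : dot (e - emm) (e - emm) <=
    2 * dot (e - em) (e - em) + 2 * dot (em - emm) (em - emm).
  have := dot_ge0 (e - em - (em - emm)).
  by rewrite !dotBl !dotBr (dotC em e) (dotC emm e) (dotC emm em); lra.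
have := ler_wpM2l (sqr_ge0 s) par.
have := ler_wpM2r (dot_ge0 (e - em)) s2.
have := ler_wpM2r (dot_ge0 (em - emm)) s2.
have dd : dot (e - em) (e - em) = dot e e - 2 * dot em e + dot em em.
  by rewrite dotBl !dotBr (dotC e em); ring.
have ddd : dot (e - emm) (e - emm) = dot e e - 2 * dot emm e + dot emm emm.
  by rewrite dotBl !dotBr (dotC e emm); ring.
rewrite dd ddd; move: (dot (em - emm) (em - emm)) => Z.
have : 2 * (k * (1 - s) * ((1 + s) * dot x e - s * dot xm e)) =
   2 * (k * (1 - s) * (dot d e - dot b e - dot a a)).
  by congr (2 * (_ * _)); lra.
rewrite main; lra.
Qed.

End Hilbert.

(** * Linearity of the difference operators and of operators on their domains *)

Lemma bdiffB (R : realType) (H : completeNormedModType R) (t : nat -> R)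
    (x y : nat -> H) n :
  bdiff t (fun j => x j - y j) n = bdiff t x n - bdiff t y n.
Proof. by rewrite /bdiff -scalerBr; congr (_ *: _); rewrite !opprD addrACA. Qed.

Lemma bdf2B (R : realType) (H : completeNormedModType R) (t : nat -> R)
    (x y : nat -> H) n :
  bdf2 t (fun j => x j - y j) n = bdf2 t x n - bdf2 t y n.
Proof. by rewrite /bdf2 !bdiffB !scalerBr !opprD addrACA. Qed.

Lemma linear_onB (R : realType) (H : completeNormedModType R) (D : set H)
    (L : H -> H) (x y : H) :
  linear_on D L -> D x -> D y -> L (x - y) = L x - L y.
Proof.
by move=> lin Dx Dy; rewrite addrC -scaleN1r lin // scaleN1r addrC.
Qed.

Lemma linear_operator_domB (R : realType) (H : completeNormedModType R)
    (L : operator H) (x y : H) :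
  linear_operator L -> dom L x -> dom L y -> dom L (x - y).
Proof. by case=> _ D _ Dx Dy; rewrite addrC -scaleN1r; apply: D. Qed.

Lemma self_adjoint_sym (R : realType) (H : completeNormedModType R)
    (dot : {dot H for (@idfun R)}) (S : operator H) (v w : H) :
  self_adjoint dot S -> dom S v -> dom S w -> dot (S v) w = dot v (S w).
Proof. by case=> _ adj Sv Sw; apply: (proj2 (adj w (S w))). Qed.

(** * The error estimate *)

Theorem theorem4p4 (R : realType) :
  (* the arguments of C are gamma, c1, c2, c3, c4, R, t^n, Phi_n *)
  exists C : R -> R -> R -> R -> R -> R -> R -> R -> R,
  forall
    (* the Hilbert space H, the operator A and its square root S *)
    (H : completeNormedModType R) (dot : {dot H for (@idfun R)})
    (A S : operator H)
    (* the lower-order operator B, possibly depending on t, and its bound *)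
    (T : R) (B : R -> H -> H) (gam : R -> R) (gmax : R)
    (* the exact solution u, its derivative du, and the data *)
    (f : R -> H) (u0 : H) (u du : R -> H)
    (* the partition and the discrete solution *)
    (N : nat) (t : nat -> R) (U : nat -> H)
    (Rr c1 c2 c3 c4 : R),
  let J : set R := `]0, T]%classic in
  let e : nat -> H := fun n => u (t n) - U n in
  let k := step t in
  induces_norm dot ->
  linear_operator A -> self_adjoint dot A -> positive_definite dot A ->
  is_sqrt_op dot A S ->
  smooth_on J gam -> (forall s, J s -> 0 <= gam s) -> is_max_on J gam gmax ->
  (forall s, J s -> linear_on (Vspace S) (B s)) ->
  (forall s v, J s -> Vspace S v -> `|B s v| <= gam s * Vnorm S v) ->
  (2 <= N)%N -> is_partition N t T ->
  {within `[0, T], continuous u} ->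
  u 0 = u0 ->
  (forall s, J s -> has_deriv_in `[0, T]%classic u s (du s)) ->
  (forall s, J s -> dom A (u s) /\ du s + A (u s) + B s (u s) = f s) ->
  (forall n, (2 <= n <= N)%N ->
     `|bdf2 t (fun j => u (t j)) n - du (t n)| <= c4 * k n ^+ 2) ->
  Vspace S (U 1%N) ->
  (forall n, (2 <= n <= N)%N ->
     Vspace S (U n) /\
     forall v, Vspace S v ->
       dot (bdf2 t U n) v + Apairing dot S (U n) v + dot (B (t n) (U n)) v
         = dot (f (t n)) v) ->
  rmax N t <= Rr -> 1 < Rr -> Rr < Num.sqrt 2 + 1 ->
  c3 = (1 + Rr) ^+ 2 / (1 + 2 * Rr - Rr ^+ 2) ->
  e 0%N = 0 ->
  (4 + 2 * Num.sqrt 2) * gmax ^+ 2 * kmax N t <= c1 -> c1 < 1 ->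
  2 * c3 * gmax ^+ 2 * kmax N t <= c2 -> c2 < 1 ->
  forall n, (2 <= n <= N)%N ->
    linf_norm e 2 n ^+ 2 + l2V_norm t S e 2 n ^+ 2
    <= C gmax c1 c2 c3 c4 Rr (t n) (Phi t n) *
       (`|e 1%N| ^+ 2 + kmax N t * Vnorm S (e 1%N) ^+ 2
        + kmax N t * k 2%N / k 1%N ^+ 2 * `|e 1%N| ^+ 2 + kmax N t ^+ 4).
Proof.
exists (fun g _ _ c3 c4 _ tn Ph => stability_const g c3 c4 tn Ph).
move=> H dot A S T B gam gmax f u0 u du N t U Rr c1 c2 c3 c4 J e k dotE.
move=> _ _ _ [linS adjS _ domA AE] _ gam0 [_ gmaxP] linB Bbd N2 [t0 tN tlt] _ _ _.
move=> ueq consist VU1 scheme rR Rr1 Rr_lt c3E e0 gk1 c11 gk2 c21 n /andP[n2 nN].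
have t_lt j : (j < n)%N -> t j < t j.+1.
  by move=> jn; apply: tlt; exact: leq_trans nN.
have ratio_le j : (2 <= j <= n)%N -> Defs.ratio t j <= Rr.
  move=> /andP[j2 jn]; apply: le_trans rR.
  by apply: le_bigmax_seq; rewrite // mem_index_iota j2 ltnS (leq_trans jn).
have kmax_ge j : (2 <= j <= n)%N -> k j <= kmax N t.
  move=> /andP[j2 jn]; rewrite /kmax.
  by apply: le_bigmax_seq; rewrite // mem_index_iota j2 ltnS (leq_trans jn).
have k0 j : (1 <= j <= n)%N -> 0 < k j by exact: step_gt0.
have Jt j : (1 <= j <= n)%N -> J (t j).
  move=> /andP[j1 jn]; rewrite /J /= in_itv /=; apply/andP; split.
    apply: lt_le_trans (t_le t_lt j1 jn); rewrite -t0; apply: t_lt.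
    exact: leq_trans jn.
  by rewrite -tN; apply: (t_le tlt) => //; exact: leq_trans nN.
have Vu j : (1 <= j <= n)%N -> Vspace S (u (t j)).
  by move=> /Jt /ueq [Au _]; move: Au; rewrite domA => -[].
have VU j : (1 <= j <= n)%N -> Vspace S (U j).
  move=> /andP[]; rewrite leq_eqVlt => /predU1P[<- //|j2] jn.
  by case: (scheme j) => //; rewrite j2 (leq_trans jn).
have Ve j : (1 <= j <= n)%N -> Vspace S (e j).
  by move=> jn; apply: linear_operator_domB => //; [exact: Vu|exact: VU].
have linS' : linear_on (dom S) S by case: linS.
pose d j := bdf2 t (fun i => u (t i)) j - du (t j).
(* [C] may depend on [t n] but not on [T], and [kmax N t] is not bounded in terms
   of [t n]. *)
pose kap := Num.min (kmax N t) (t n).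
have gmax0 : 0 <= gmax.
  have J1 := Jt n; rewrite leqnn (ltnW n2) in J1.
  by apply: le_trans (gam0 _ (J1 isT)) _; apply: gmaxP; exists (t n) => //; exact: J1.
have b_le j : (2 <= j <= n)%N ->
    dot (B (t j) (e j)) (B (t j) (e j)) <= gmax ^+ 2 * dot (S (e j)) (S (e j)).
  move=> /andP[j2 jn]; have j1 : (1 <= j <= n)%N by rewrite jn (ltnW j2).
  rewrite !dotE -exprMn lerXn2r ?nnegrE ?mulr_ge0 //.
  apply: le_trans (Bbd _ _ (Jt _ j1) (Ve _ j1)) _.
  apply: ler_wpM2r; first exact: normr_ge0.
  by apply: gmaxP; exists (t j) => //; exact: Jt.
have kkap j : (2 <= j <= n)%N -> k j <= kap.
  move=> jn; rewrite le_min kmax_ge //= step_le_t //.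
  by case/andP: jn => /ltnW -> ->.
have d_le j : (2 <= j <= n)%N -> dot (d j) (d j) <= c4 ^+ 2 * kap ^+ 4.
  move=> jn; have /andP[j2 jn'] := jn.
  have kj : 0 <= k j by rewrite ltW // k0 // jn' ltnW.
  have dj : `|d j| <= c4 * k j ^+ 2.
    by apply: consist; rewrite j2 (leq_trans jn').
  rewrite dotE; apply: (@le_trans _ _ ((c4 * k j ^+ 2) ^+ 2)).
    by rewrite lerXn2r ?nnegrE // (le_trans _ dj).
  rewrite exprMn -exprM ler_wpM2l ?sqr_ge0 //.
  by rewrite lerXn2r ?nnegrE ?kkap // (le_trans kj) // kkap.
(* The scheme is subtracted from the differential equation tested with [v]. As [u (t j)] lies in
   [dom A], symmetry of [S] turns [dot (A (u (t j))) v] into the pairing used by the scheme. *)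
have error j v : (2 <= j <= n)%N -> Vspace S v ->
    dot (bdf2 t e j) v + dot (S (e j)) (S v) + dot (B (t j) (e j)) v
    = dot (d j) v.
  move=> /andP[j2 jn] Vv; have j1 : (1 <= j <= n)%N by rewrite jn (ltnW j2).
  have [Au ueqj] := ueq _ (Jt _ j1).
  have [|_ /(_ v Vv) schj] := scheme j; first by rewrite j2 (leq_trans jn).
  have SSu : dom S (S (u (t j))) by move: Au; rewrite domA => -[].
  have Auv : dot (A (u (t j))) v = dot (S (u (t j))) (S v).
    by rewrite AE // self_adjoint_sym.
  have dotu : dot (du (t j)) v + dot (S (u (t j))) (S v)
      + dot (B (t j) (u (t j))) v = dot (f (t j)) v.
    by rewrite -ueqj dotDl dotDl Auv.
  have -> : bdf2 t e j = bdf2 t (fun i => u (t i)) j - bdf2 t U j by exact: bdf2B.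
  have -> : S (e j) = S (u (t j)) - S (U j).
    exact: linear_onB linS' (Vu _ j1) (VU _ j1).
  have -> : B (t j) (e j) = B (t j) (u (t j)) - B (t j) (U j).
    exact: linear_onB (linB _ (Jt _ j1)) (Vu _ j1) (VU _ j1).
  move: schj; rewrite /d /Apairing.
  rewrite (dotBl dot (bdf2 _ _ _)) (dotBl dot (S _)) (dotBl dot (B _ _)).
  rewrite (dotBl dot (bdf2 _ _ _)); lra.
have linf (M : R) : (forall j, (2 <= j <= n)%N -> dot (e j) (e j) <= M) ->
    linf_norm e 2 n ^+ 2 <= M.
  move=> eM; have M0 : 0 <= M.
    by apply: le_trans (dot_ge0 dotE (e n)) (eM _ _); rewrite n2 leqnn.
  rewrite -(sqr_sqrtr M0) lerXn2r ?nnegrE ?sqrtr_ge0 //.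
    by apply: bigmax_ge_id.
  rewrite /linf_norm big_nat; apply: bigmax_le; first exact: sqrtr_ge0.
  move=> j jn; rewrite -(ler_pXn2r (n:=2)) ?nnegrE ?sqrtr_ge0 //.
  by rewrite sqr_sqrtr // -dotE eM.
have l2 : l2V_norm t S e 2 n ^+ 2 =
    \sum_(2 <= j < n.+1) k j * dot (S (e j)) (S (e j)).
  rewrite sqr_sqrtr; last first.
    apply: sum_nat_ge0 => j /andP[j2]; rewrite ltnS => jn.
    by rewrite mulr_ge0 ?sqr_ge0 // ltW // k0 // jn (ltnW j2).
  by apply: eq_bigr => j _; rewrite dotE.
have kdiff j : (1 <= j <= n)%N -> k j *: bdiff t e j = e j - e j.-1.
  by move=> jn; rewrite scalerA mulfV ?scale1r // gt_eqF // k0.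
have kap_le : kap <= kmax N t by rewrite ge_min lexx.
have kap0 : 0 <= kap.
  have := kkap 2; rewrite n2 => /(_ isT); apply: le_trans.
  by rewrite ltW // k0.
have g2 : 0 <= gmax ^+ 2 := sqr_ge0 _.
have c30 : 0 < c3 by rewrite c3E; apply: lt_trans (c3_gt1 Rr1 Rr_lt).
have p0 : 0 < 2 + Num.sqrt 2 :> R by rewrite ltr_wpDr ?sqrtr_ge0.
have jm1 j : (2 <= j <= n)%N -> (1 <= j.-1 <= n)%N.
  by case: j => [//|j] /andP[j2 /ltnW ->]; rewrite -ltnS j2.
have jw j : (2 <= j <= n)%N -> (1 <= j <= n)%N.
  by case/andP=> /ltnW -> ->.
have tn0 : 0 < t n 
  by have := Jt n; rewrite leqnn (ltnW n2) /J /= in_itv /= => /(_ isT) /andP[].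
have kapt : kap <= t n by rewrite ge_min lexx orbT.
have [M EM Mle] : exists2 M, (forall j, (2 <= j <= n)%N -> dot (e j) (e j) <= M)
    & M + \sum_(2 <= j < n.+1) k j * dot (S (e j)) (S (e j)) <=
      stability_const gmax c3 c4 (t n) (Phi t n) *
      (dot (e 1%N) (e 1%N) + kap * dot (S (e 1%N)) (S (e 1%N))
       + kap * k 2%N / k 1%N ^+ 2 * dot (e 1%N) (e 1%N) + kap ^+ 4).
  rewrite c3E; apply: (bdf2_stability t0 t_lt ratio_le Rr1 Rr_lt
    (X := fun j => dot (bdiff t e j) (bdiff t e j))) => //.
  - by move=> j; exact: dot_ge0.
  - by move=> j; exact: dot_ge0.
  - by move=> j; exact: dot_ge0.
  - have := kdiff 1%N; rewrite (ltnW n2) e0 subr0 => /(_ isT) <-.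
    by rewrite dotZl dotZr mulrA expr2.
  - apply: le_trans (ltW c11); apply: le_trans gk1; apply: ler_wpM2l => //.
    by rewrite mulr_ge0 // addr_ge0 // mulr_ge0 // sqrtr_ge0.
  - rewrite -c3E; apply: le_trans (ltW c21); apply: le_trans gk2.
    apply: ler_wpM2l => //.
    by rewrite mulr_ge0 // mulr_ge0 // ltW.
  - move=> j jn; have /andP[j2 jn'] := jn; have j1 := jw _ jn.
    (* The parameter [q] of [difference_step] is [p^-1], so [p] has to appear as [q^-1]. *)
    rewrite -[X in 4 / 3 * X]invrK -[X in 8 * X]invrK.
    apply: (@difference_step _ _ dot dotE _ _ _ _ (B (t j) (e j)) (d j)) => //.
    - exact: k0.
    - exact: (sratio_ge0 t_lt).
    - exact: b_le.
    - exact: d_le.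
    (* Since [j.-1 >= 1], both errors lie in V and their difference is an admissible test
       function. *)
    have jm := jm1 _ jn; have Vj := Ve _ j1; have Vjm := Ve _ jm.
    rewrite kdiff //; have <- := linear_onB linS' Vj Vjm.
    by apply: error => //; exact: linear_operator_domB.
  - move=> j jn; have /andP[j2 jn'] := jn; have j1 := jw _ jn; have jm := jm1 _ jn.
    rewrite -c3E.
    apply: (@energy_step _ _ dot dotE _ _ _ (bdiff t e j) _ _
      (B (t j) (e j)) (d j)) => //.
    - exact: k0.
    - exact: k0.
    - exact: (sratio_ge0 t_lt).
    - exact: (sratio_le t_lt ratio_le Rr1 Rr_lt).
    - apply: le_trans (sratio_sqr_le t_lt ratio_le Rr1 Rr_lt j1) _.
      rewrite -c3E; have : 0 < c3^-1 by rewrite invr_gt0.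
      lra.
    - by rewrite invr_gt0 mulr_gt0 // mulr_gt0.
    - exact: kdiff.
    - exact: kdiff.
    - exact: b_le.
    - exact: d_le.
    by apply: error => //; exact: Ve.
rewrite l2; apply: le_trans (lerD (linf _ EM) (lexx _)) _.
(* The constant is nonnegative and the data increase with [kap], so [kap] may be replaced by
   [kmax N t]. *)
apply: le_trans Mle _; apply: ler_wpM2l.
  by rewrite c3E; apply: stability_const_ge0 => //; [exact: ltW|exact: Phi_ge0].
rewrite /Vnorm -!dotE -!mulrA.
have E10 := dot_ge0 dotE (e 1%N); have Y10 := dot_ge0 dotE (S (e 1%N)).
have k20 : 0 <= k 2%N / k 1%N ^+ 2 * dot (e 1%N) (e 1%N).
  by rewrite mulr_ge0 // divr_ge0 ?sqr_ge0 // ltW // k0.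
rewrite -!mulrA in k20.
apply: lerD; last by rewrite lerXn2r // nnegrE // (le_trans kap0).
apply: lerD; first by apply: lerD => //; rewrite ler_wpM2r.
by rewrite ler_wpM2r.
Qed.
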